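(* Let $(M,\mathcal C)$ be a differential space such that $(M,\tau_{\mathcal C})$ is Hausdorff, and let $(\mathrm{compl}_{\mathcal C}M,\mathrm{compl}_{\mathcal C}\mathcal C)$ be its differential completion defined by the family $\mathcal C$ itself (taken as a family of generators of $\mathcal C$). Then: (i) for every differential completion $(N,\mathcal D)$ of $(M,\mathcal C)$ (where $M\subset N$ via the canonical identification), there exists a smooth map $\iota_{\mathcal D}:(\mathrm{compl}_{\mathcal C}M,\mathrm{compl}_{\mathcal C}\mathcal C)\to(N,\mathcal D)$ such that $\iota_{\mathcal D}|_M=\mathrm{id}_M$; (ii) for every $g\in\mathcal C$ there exists a uniquely defined extension $\tilde g\in\mathrm{compl}_{\mathcal C}\mathcal C$ of $g$ (i.e. a unique $\tilde g\in \mathrm{compl}_{\mathcal C}\mathcal C$ with $\tilde g|_M=g$).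
   Context: Differential spaces (Sikorski). For a nonempty set $M$ and a family $\mathcal C$ of functions $M\to\mathbb R$, $\tau_{\mathcal C}$ is the weakest topology on $M$ making all functions of $\mathcal C$ continuous. $\mathcal C$ is a differential structure on $M$ if: (a) every $f:M\to\mathbb R$ such that each $m\in M$ has a $\tau_{\mathcal C}$-neighbourhood $V$ and some $\alpha\in\mathcal C$ with $f|_V=\alpha|_V$ belongs to $\mathcal C$; and (b) $\omega\circ(\alpha_1,\dots,\alpha_n)\in\mathcal C$ for all $n\in\mathbb N$, $\omega\in C^\infty(\mathbb R^n)$, $\alpha_1,\dots,\alpha_n\in\mathcal C$. Then $(M,\mathcal C)$ is a differential space. For a family $\mathcal F$ of real functions on $M$, $\mathrm{gen}(\mathcal F)$ is the smallest differential structure on $M$ containing $\mathcal F$; if $\mathcal C=\mathrm{gen}(\mathcal F)$, then $\mathcal F$ is a family of generators of $\mathcal C$. A map $F:(M,\mathcal C)\to(N,\mathcal D)$ between differential spaces is smooth if $\beta\circ F\in\mathcal C$ for all $\beta\in\mathcal D$. Uniform structure of a family of generators. If $\mathcal G$ is a family of generators of $\mathcal C$ and $(M,\tau_{\mathcal C})$ is Hausdorff (equivalently, $\mathcal G$ separates points), then $\mathcal U_{\mathcal G}$ is the uniform structure on $M$ with base consisting of the sets $\{(x,y)\in M\times M: |f_i(x)-f_i(y)|<\varepsilon,\ i=1,\dots,k\}$, $k\in\mathbb N$, $f_1,\dots,f_k\in\mathcal G$, $\varepsilon>0$. Differential completion. Let $(\widetilde M,\widetilde{\mathcal U}_{\mathcal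 G})$ be the (Hausdorff) completion of the uniform space $(M,\mathcal U_{\mathcal G})$, with $M$ identified with its canonical dense image in $\widetilde M$. Each $g\in\mathcal G$ has a continuous extension $\tilde g:\widetilde M\to\mathbb R$; put $\widetilde{\mathcal G}=\{\tilde g:g\in\mathcal G\}$. The differential completion of $(M,\mathcal C)$ defined by $\mathcal G$ is $(\mathrm{compl}_{\mathcal G}M,\mathrm{compl}_{\mathcal G}\mathcal C):=(\widetilde M,\mathrm{gen}(\widetilde{\mathcal G}))$. Equivalently, up to canonical identification, $\mathrm{compl}_{\mathcal G}M$ is the closure in $\mathbb R^{\mathcal G}$ (product topology) of the image of $\phi_{\mathcal G}:M\to\mathbb R^{\mathcal G}$, $\phi_{\mathcal G}(m)=(g(m))_{g\in\mathcal G}$, $M$ is identified with $\phi_{\mathcal G}(M)$, and $\mathrm{compl}_{\mathcal G}\mathcal C$ is generated by the restrictions of the coordinate projections. ''A differential completion of $(M,\mathcal C)$'' means $(\mathrm{compl}_{\mathcal G}M,\mathrm{compl}_{\mathcal G}\mathcal C)$ for some family $\mathcal G$ of generators of $\mathcal C$. *)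

(* Defs.v *)
From HB Require Import structures.
From mathcomp Require Import all_boot all_order all_algebra.
From mathcomp Require Import finmap.
From mathcomp Require Import all_classical all_reals all_analysis.

Set Implicit Arguments.
Unset Strict Implicit.
Unset Printing Implicit Defensive.

Import Order.TTheory GRing.Theory Num.Theory.
Import numFieldNormedType.Exports.

Local Open Scope classical_set_scope.
Local Open Scope ring_scope.

(* w is of class C^k on R^n: the iterated partial derivatives of w up to
   order k exist everywhere and are continuous. *)
Fixpoint Ck {R : realType} {n : nat} (k : nat) (w : 'rV[R]_n -> R) : Prop :=
  continuous w /\
  if k is k'.+1 then
    forall i : 'I_n, (forall x, derivable w x (delta_mx 0 i)) /\
                     Ck k' (fun x => 'D_(delta_mx 0 i) w x)
  else True.

Definition Cinfty {R : realType} {n : nat} (w : 'rV[R]_n -> R) : Prop :=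
  forall k, Ck k w.

(* M endowed with the weakest topology making every function of C continuous. *)
Definition tau {R : realType} {M : choiceType} (C : set (M -> R)) :
    topologicalType :=
  sup_topology (fun f : C => Topological.class (initial_topology (val f))).

Definition diff_structure {R : realType} {M : choiceType}
    (C : set (M -> R)) : Prop :=
  (forall f : M -> R,
     (forall m : M, exists (V : set M) (a : M -> R),
        [/\ @nbhs _ (tau C) m V, C a & {in V, f =1 a}]) ->
     C f) /\
  (forall (n : nat) (w : 'rV[R]_n -> R) (a : 'I_n -> M -> R),
     Cinfty w -> (forall i, C (a i)) -> C (fun m => w (\row_i a i m))).

Definition gen {R : realType} {M : choiceType} (F : set (M -> R)) :
    set (M -> R) :=
  smallest diff_structure F.

Definition generators {R : realType} {M : choiceType}
    (G C : set (M -> R)) : Prop := gen G = C.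

Definition smooth_map {R : realType} {M N : choiceType}
    (C : set (M -> R)) (D : set (N -> R)) (F : M -> N) : Prop :=
  forall b, D b -> C (b \o F).

(* The entourages of the uniform structure U_G. *)
Definition unif_ent {R : realType} {M : choiceType} (G : set (M -> R)) :
    set_system (M * M) :=
  [set E | exists (k : nat) (f : 'I_k -> M -> R) (e : R),
     [/\ forall i, G (f i), 0 < e &
         [set xy | forall i, `|f i xy.1 - f i xy.2| < e] `<=` E]].

(* (N, j) is a Hausdorff completion of the uniform space (M, U): N is a complete
   Hausdorff uniform space and j is an isomorphism of (M, U) onto a dense
   uniform subspace of N. This determines (N, j) up to a unique isomorphism. *)
Definition uniform_completion {M : choiceType} (U : set_system (M * M))
    (N : completeType) (j : M -> N) : Prop :=
  [/\ hausdorff_space N, injective j, dense (range j) & @initial_ent M N j = U].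

(* The set of the continuous extensions to N, along j, of the functions of G. *)
Definition extensions {R : realType} {M : choiceType} (G : set (M -> R))
    (N : completeType) (j : M -> N) : set (N -> R) :=
  [set h | continuous h /\ G (h \o j)].

(* (N, D) is, with M identified with its image by j, the differential
   completion of (M, C) defined by the family G of generators of C. *)
Definition diff_completion {R : realType} {M : choiceType}
    (C G : set (M -> R)) (N : completeType) (j : M -> N) (D : set (N -> R)) :
    Prop :=
  [/\ generators G C, uniform_completion (unif_ent G) j &
      D = gen (extensions G j)].

(* Completions exist: take the closure of the image of M in R^G. *)
Section existence.
Context {R : realType} {M : pointedType} (G : set (M -> R)).
Let P : uniformType := {ptws G -> R}.
Let phi (m : M) : P := fun g => val g m.
Let A : set P := closure (range phi).

Local Lemma ptws_ent (g : G) (e : R) : 0 < e ->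
  @entourage P [set pq | `|pq.1 g - pq.2 g| < e].
Proof.
move=> e0.
have E : @entourage (initial_topology (@proj G (fun=> R : uniformType) g)) [set pq | `|pq.1 g - pq.2 g| < e].
  exists [set xy | `|xy.1 - xy.2| < e] => //.
  by rewrite -entourage_ballE; exists e.
pose Q : {classic G} * set (P * P) := (g : {classic G}, [set pq : P * P | `|pq.1 g - pq.2 g| < e]).
have HQ : `[< @entourage (initial_topology (@proj G (fun=> R : uniformType) Q.1)) Q.2 >] by apply/asboolP.
rewrite /entourage /= /sup_ent.
exists Q.2 => //.
exists [fset (exist _ Q HQ)]%fset => /=; first by move=> ? _; rewrite inE.
apply/seteqP; split=> [x Hx|x Qx i /=].
  by apply: (Hx (exist _ Q HQ)) => /=; exact: fset11.
by move=> /fset1P ->.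
Qed.

Local Lemma ptws_ent_base (E : set (P * P)) : @entourage P E ->
  exists (k : nat) (f : 'I_k -> G) (e : R),
  0 < e /\ [set pq | forall i, `|pq.1 (f i) - pq.2 (f i)| < e] `<=` E.
Proof.
rewrite /entourage /= /sup_ent => -[B [F _ <-] BE].
suff: exists (k : nat) (f : 'I_k -> G) (e : R),
  0 < e /\ forall p, p \in enum_fset F -> [set pq | forall i, `|pq.1 (f i) - pq.2 (f i)| < e] `<=` (projT1 p).2.
  move=> [k [f [e [e0 H]]]]; exists k, f, e; split=> // pq Hpq; apply: BE => p pF.
  exact: (H p pF).
elim: (enum_fset F) => [|p s [k [f [e [e0 IH]]]]].
  by exists 0%N, (fun i : 'I_0 => False_rect G (notF (eq_trans (esym (ltn0 i)) (ltn_ord i)))), 1; split.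
case: p => -[g C] /= /[dup] /asboolP /= [D].
rewrite -entourage_ballE => -[d /= d0 dD] DC HC.
exists k.+1, (fun i => if unlift ord0 i is Some j then f j else g), (Num.min e d).
split; first by rewrite lt_min e0 d0.
move=> p; rewrite inE => /orP[/eqP -> /=|ps] pq /= H.
  apply: DC; apply: dD => /=; have := H ord0; rewrite unlift_none => /lt_le_trans; apply.
  by rewrite ge_min lexx orbT.
apply: (IH p ps) => /= i; have := H (lift ord0 i); rewrite liftK => /lt_le_trans; apply.
by rewrite ge_min lexx.
Qed.

Let pt : A := exist _ (phi point) (mem_set (subset_closure (ex_intro2 _ _ point I erefl))).
Let N0 : puniformType := HB.pack (set_type A) (Uniform.class (set_type A)) (isPointed.Build (set_type A) pt).

Local Lemma N0_complete (F : set_system N0) : ProperFilter F -> cauchy F -> cvg F.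
Proof.
move=> FF cF.
pose pr (g : G) (a : N0) : R := (set_val a : P) g.
have cg g : cvg (pr g @ F).
  apply: cauchy_cvg => E; rewrite -entourage_ballE => -[e /= e0 eE].
  have /cF : @entourage N0 [set ab | `|pr g ab.1 - pr g ab.2| < e].
    by exists [set pq | `|pq.1 g - pq.2 g| < e] => //; exact: ptws_ent.
  move=> [[X Y] /= [FX FY] XY].
  exists (pr g @` (X `&` Y), pr g @` (X `&` Y)) => /=.
    have H : F (X `&` Y) by exact: filterI.
    have H' : F (pr g @^-1` (pr g @` (X `&` Y))) by apply: filterS H => a XYa; exists a.
    by split; exact: H'.
  move=> [a b] /= [[a' [Xa _] <-] [b' [_ Yb] <-]]; apply: eE => /=.
  exact: (XY (a', b')).
pose x : P := fun g => lim (pr g @ F).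
have Fx : (set_val : N0 -> P) @ F --> x.
  apply/cvg_entourageP => E /ptws_ent_base [k [f [e [e0 sE]]]].
  have : \forall a \near F, forall i, `|x (f i) - pr (f i) a| < e.
    apply: filter_forall => i.
    by move/cvgrPdist_lt: (cg (f i)); apply.
  by apply: filterS => a Ha; apply: sE.
have Ax : A x.
  rewrite /A; have -> := (closure_id _).1 (@closed_closure _ (range phi)).
  move=> B xB; have FB : F (set_val @^-1` B) := Fx B xB.
  have [a Ba] := filter_ex FB.
  by exists (set_val a); split => //; apply: set_mem; exact: valP.
suff : F --> (exist _ x (mem_set Ax) : N0) by move=> H; apply/cvg_ex; eexists; exact: H.
move=> B [C [[D oD <-] Dx] DB]; apply: filterS DB _.
by apply: Fx; exact: open_nbhs_nbhs.
Unshelve. all: by end_near. Qed.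

Let N : completeType := HB.pack (N0 : Type) (PointedUniform.class N0) (Uniform_isComplete.Build (PointedUniform.sort N0) N0_complete).

Lemma uniform_completion_exists : (forall x y : M, (forall g, G g -> g x = g y) -> x = y) ->
  exists (N : completeType) (j : M -> N), uniform_completion (unif_ent G) j.
Proof.
move=> sep.
pose j (m : M) : N := exist _ (phi m) (mem_set (subset_closure (ex_intro2 _ _ m I erefl))).
exists N, j; split.
- move=> p q pq; apply: val_inj; apply: (@hausdorff_product G (fun=> R)) => [?|].
    exact: Rhausdorff.
  move=> U V Up Vq.
  have := pq (set_val @^-1` U) (set_val @^-1` V).
  case.
  + by apply: (@initial_continuous A P set_val).
  + by apply: (@initial_continuous A P set_val).
  by move=> a [Ua Va]; exists (val a).
- move=> x y /(congr1 val) /= e; apply: sep => g Gg.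
  exact: (congr1 (fun h : P => h (exist _ g (mem_set Gg))) e).
- move=> O [a Oa] [D oD DO].
  have : A (val a) by apply: set_mem; exact: (valP (a : A)).
  move=> /(_ D) []; first by apply: open_nbhs_nbhs; split => //; rewrite -DO in Oa.
  by move=> _ [[m _ <-] Dm]; exists (j m); split; [rewrite -DO|exists m].
- apply/seteqP; split => E.
  + move=> [E1 [E' /ptws_ent_base [k [f [e [e0 sE]]]] E'1] sub].
    exists k, (fun i => val (f i)), e; split => // [i|[a b] /= H].
      exact: set_mem (valP (f i)).
    apply: sub => /=; apply: E'1; apply: sE => /=; exact: H.
  + move=> [k [f [e [Gf e0 sE]]]].
    pose f' i : G := exist _ (f i) (mem_set (Gf i)).
    exists [set pq | forall i, `|(set_val pq.1 : P) (f' i) - (set_val pq.2 : P) (f' i)| < e].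
      exists [set pq : P * P | forall i, `|pq.1 (f' i) - pq.2 (f' i)| < e] => //.
      have : \forall pq \near @entourage P, forall i, `|pq.1 (f' i) - pq.2 (f' i)| < e.
        by apply: filter_forall => i; exact: (ptws_ent (f' i) e0).
      by [].
    by move=> [a b] /= H; apply: sE.
Qed.
End existence.

Local Lemma tau_nbhs_eq {R : realType} {M : choiceType} (C : set (M -> R))
    (x y : M) (V : set M) :
  (forall f, C f -> f x = f y) -> @nbhs _ (tau C) x V -> V y.
Proof.
move=> Cxy xV.
suff /(_ y erefl) : globally [set y] V by [].
have H : globally [set y] --> (x : tau C).
  apply/(cvg_sup _ _ (globally_filter [set y])) => f B [D [[E oE <-] Ex] sB].
  by move=> _ ->; apply: sB; rewrite /preimage /= -(Cxy _ (set_mem (valP f))).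
exact: H xV.
Qed.

Lemma diff_completion_exists {R : realType} {M : pointedType}
    (C G : set (M -> R)) :
  hausdorff_space (tau C) -> generators G C ->
  exists (N : completeType) (j : M -> N) (D : set (N -> R)),
    diff_completion C G j D.
Proof.
move=> hM GC.
suff /uniform_completion_exists[N [j jP]] :
    forall x y : M, (forall g, G g -> g x = g y) -> x = y.
  by exists N, j, (gen (extensions G j)).
move=> x y Gxy; apply: hM => A B xA yB; exists y; split; last first.
  exact: (nbhs_singleton yB).
apply: tau_nbhs_eq xA => f; rewrite -GC => /(_ [set f | f x = f y]); apply.
split=> //; split=> [h loc|n w a _ axy] /=.
- have [V [a [xV axy Va]]] := loc x.
  rewrite !Va ?inE //; first exact: (tau_nbhs_eq _ xV).
  exact: (nbhs_singleton xV).
- by congr w; apply/rowP => i; rewrite !mxE; exact: axy.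
Qed.

(* Main.v *)
(* If G generates C then G is contained in C, so U_C is finer than U_G and the
   embedding of M in its G-completion is uniformly continuous for U_C; so is
   every g in C.  Both therefore extend by density to the C-completion.
   Composition with the extended map sends generators to continuous extensions
   of elements of C, hence it is smooth.  Uniqueness holds because continuous
   functions form a differential structure: every function of compl_C C is
   continuous, hence determined by its values on the dense subset M. *)
Require Import Defs.
From HB Require Import structures.
From mathcomp Require Import all_boot all_order all_algebra.
From mathcomp Require Import all_classical all_reals all_analysis.

Set Implicit Arguments.
Unset Strict Implicit.
Unset Printing Implicit Defensive.

Import Order.TTheory GRing.Theory Num.Theory.
Import numFieldNormedType.Exports.

Local Open Scope classical_set_scope.
Local Open Scope ring_scope.

(** The value at [p] is the limit of the traces on [M] of the neighbourhoods of [p], pushed to [T]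
    by [j]. The inclusion of entourages is the uniform continuity of [j], which makes these filters
    Cauchy. *)
Lemma extend_by_density {M : choiceType} {X : uniformType} {T : completeType}
    (i : M -> X) (j : M -> T) :
  dense (range i) -> hausdorff_space T ->
  @initial_ent M T j `<=` @initial_ent M X i ->
  exists f : X -> T, continuous f /\ forall m, f (i m) = j m.
Proof.
move=> di hT ji.
pose Fl (p : X) : set_system T :=
  filter_from (nbhs p) (fun U => j @` (i @^-1` U)).
have FlF p : ProperFilter (Fl p).
  apply: filter_from_proper => [|U pU].
    apply: filter_from_filter; first by exists setT; exact: filterT.
    move=> U V pU pV; exists (U `&` V); first exact: filterI.
    by move=> _ [m [Um Vm] <-]; split; exists m.
  have [] := di U°; first by exists p; exact: pU.
    exact: open_interior.
  move=> x [/interior_subset Ux [m _ mx]].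
  by exists (j m), m => //=; rewrite mx.
have Flc p : cauchy (Fl p).
  move=> E entE.
  have [|E' entE' E'E] := ji [set mn | E (j mn.1, j mn.2)]; first by exists E.
  (* Both orders are required because [p] is the middle point of the chain from [i m] to [p] to
     [i n]. *)
  pose U := [set q | split_ent E' (q, p) /\ split_ent E' (p, q)].
  have pU : nbhs p U.
    apply: filterI.
      apply/nbhsP; exists ((split_ent E')^-1)%relation.
        exact: entourage_inv.
      by move=> q; rewrite /xsection/= inE.
    apply/nbhsP; exists (split_ent E') => //.
    by move=> q; rewrite /xsection/= inE.
  exists (j @` (i @^-1` U), j @` (i @^-1` U)); first by split; exists U.
  move=> [_ _] [/= [m [mp _] <-] [n [_ pn] <-]].
  by apply: (E'E (m, n)); exact: entourage_split mp pn.
have Fll p : Fl p --> lim (Fl p) by exact: cauchy_cvg.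
exists (fun p => lim (Fl p)); split=> [p B /uniform_regular[B0 fpB0 B0B]|m].
  (* For [q] near [p], the filter [Fl q] still contains [B0], so its limit lies in the closure of
     [B0], which regularity places inside [B]. *)
  have [U pU UB0] := Fll p _ fpB0.
  have : nbhs p U° by exact: nbhs_interior.
  apply: filterS => q qU; apply: B0B => V fqV.
  by apply: (@filter_ex _ (Fl q)); apply: filterI; [exists U|exact: Fll].
apply: (cvg_unique hT (Fll _)) => B /nbhsP[E entE EB].
have [|E' entE' E'E] := ji [set mn | E (j mn.1, j mn.2)]; first by exists E.
exists (xsection E' (i m)); first by apply/nbhsP; exists E'.
move=> _ [n /= mn <-]; apply: EB; rewrite /xsection/= inE.
by apply: (E'E (m, n)) => /=; move: mn; rewrite /xsection/= inE.
Qed.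

Lemma continuous_eq_on_dense {X T : topologicalType} (A : set X)
    (f g : X -> T) :
  hausdorff_space T -> continuous f -> continuous g -> dense A ->
  {in A, f =1 g} -> f = g.
Proof.
move=> hT cf cg dA fg; apply/funext => p; apply: hT => U V fU gV.
have pUV : nbhs p (f @^-1` U `&` g @^-1` V).
  by apply: filterI; [exact: cf|exact: cg].
have [] := dA (f @^-1` U `&` g @^-1` V)°.
- by exists p; exact: pUV.
- exact: open_interior.
- move=> q [/interior_subset[Uq Vq] Aq]; exists (f q); split=> //.
  by rewrite fg ?inE.
Qed.

Section differential_structures.
Context {R : realType}.

Lemma tau_cvgP {M : choiceType} (C : set (M -> R)) (F : set_system M) (x : M) :
  Filter F ->
  (F --> (x : tau C)) <-> (forall f, C f -> f @ F --> f x).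
Proof.
move=> FF; rewrite cvg_sup; split=> [h f Cf B fB|h f B [_ [[E oE <-] Ex]]].
  apply: (h (exist _ f (mem_set Cf))).
  exact: (@initial_continuous M R f).
move=> EB; apply: filterS EB _.
by apply: (h _ (set_mem (valP f))); exact: open_nbhs_nbhs.
Qed.

Lemma smooth_map_continuous {M N : choiceType} (C : set (M -> R))
    (D : set (N -> R)) (F : M -> N) :
  smooth_map C D F -> continuous (F : tau C -> tau D).
Proof.
move=> sF x; have Fx : Filter (nbhs (x : tau C)) by exact: nbhs_filter.
apply/(@tau_cvgP _ D (F @ nbhs (x : tau C)) (F x) _) => b Db.
have /(tau_cvgP C) h : nbhs (x : tau C) --> (x : tau C) by [].
by apply: h; exact: sF.
Qed.

Lemma nbhs_tau_continuous {X : topologicalType} (C : set (X -> R)) (x : X)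
    (V : set X) :
  (forall f, C f -> continuous f) -> @nbhs _ (tau C) x V -> nbhs x V.
Proof.
move=> Cc; suff : nbhs x --> (x : tau C) by exact.
by apply/tau_cvgP => f /Cc; apply.
Qed.

Lemma sub_gen {M : choiceType} (F : set (M -> R)) : F `<=` gen F.
Proof. by move=> f Ff S [_]; apply. Qed.

Lemma diff_structure_gen {M : choiceType} (F : set (M -> R)) :
  diff_structure (gen F).
Proof.
split=> [f loc S [dS FS]|n w a wC Fa S [dS FS]].
  apply: dS.1 => m; have [V [a [mV Fa Va]]] := loc m.
  exists V, a; split=> //; last exact: Fa.
  (* Since [gen F] is contained in [S], the identity is smooth from [S] to [gen F]; its continuity
     turns a [tau (gen F)]-neighbourhood into a [tau S]-neighbourhood. *)
  apply: (@smooth_map_continuous _ _ S (gen F) id) mV => b Fb.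
  exact: (Fb S).
by apply: dS.2 => // i; exact: Fa.
Qed.

(** This is the largest structure on [N] making [F] smooth. Local witnesses pull back because [F] is
    continuous for the two weak topologies. *)
Lemma diff_structure_pushforward {M N : choiceType} (C : set (M -> R))
    (F : M -> N) :
  diff_structure C -> diff_structure [set b : N -> R | C (b \o F)].
Proof.
move=> dC; split=> [f loc|n w a wC Ca]; last exact: (dC.2 _ _ _ wC Ca).
apply: dC.1 => m; have [V [a [mV Ca Va]]] := loc (F m).
exists (F @^-1` V), (a \o F); split=> //.
  by apply: (smooth_map_continuous _ mV) => b.
by move=> x; rewrite inE => Vx /=; rewrite Va ?inE.
Qed.

(** By minimality of [gen G] against the pushforward of [C], smoothness can be tested on
    generators. *)
Lemma smooth_map_gen {M N : choiceType} (C : set (M -> R)) (G : set (N -> R))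
    (F : M -> N) :
  diff_structure C -> (forall b, G b -> C (b \o F)) -> smooth_map C (gen G) F.
Proof.
move=> dC GC b /(_ [set b : N -> R | C (b \o F)]); apply; split=> //.
exact: diff_structure_pushforward.
Qed.

Lemma continuous_row {X : topologicalType} n (a : 'I_n -> X -> R) :
  (forall i, continuous (a i)) -> continuous (fun x => \row_i a i x).
Proof.
move=> ca x B [P xP PB].
have : \forall y \near x, forall i, P 0 i (a i y).
  by apply: filter_forall => i; apply: ca; have := xP 0 i; rewrite mxE.
by apply: filterS => y Py; apply: PB => i k; rewrite mxE (ord1 i).
Qed.

Lemma diff_structure_continuous {X : topologicalType} :
  diff_structure [set f : X -> R | continuous f].
Proof.
split=> [f loc x|n w a wC ca x].
  have [V [a [xV ca Va]]] := loc x.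
  (* The weak topology of a family of continuous functions is coarser than that of [X]. *)
  have {}xV : nbhs x V by apply: nbhs_tau_continuous xV.
  rewrite /continuous_at Va ?inE; last exact: nbhs_singleton.
  apply: cvg_trans (ca x); apply: near_eq_cvg.
  by apply: filterS xV => y Vy; rewrite Va ?inE.
apply: (@continuous_comp _ _ _ (fun x => \row_i a i x) w).
  exact: continuous_row.
(* Order zero of [Cinfty] is continuity. *)
by have [cw _] := wC 0%N; exact: cw.
Qed.

Lemma gen_continuous {X : topologicalType} (F : set (X -> R)) :
  (forall f, F f -> continuous f) -> forall f, gen F f -> continuous f.
Proof.
move=> Fc f /(_ [set h : X -> R | continuous h]); apply; split=> //.
exact: diff_structure_continuous.
Qed.

Lemma unif_ent_sub {M : choiceType} (G C : set (M -> R)) :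
  G `<=` C -> unif_ent G `<=` unif_ent C.
Proof.
by move=> GC E [k [f [e [Gf e0 fE]]]]; exists k, f, e; split=> // i; exact: GC.
Qed.

(** Uniform continuity of [g], in the form that [extend_by_density] takes; the basic entourages
    given by [g] alone suffice. *)
Lemma initial_ent_sub_unif_ent {M : choiceType} (C : set (M -> R))
    (g : M -> R) :
  C g -> @initial_ent M R g `<=` unif_ent C.
Proof.
move=> Cg E [B]; rewrite -entourage_ballE => -[e /= e0 eB] BE.
exists 1%N, (fun=> g), e; split=> // -[x y] /= /(_ ord0) xye.
by apply: BE; apply: eB.
Qed.

End differential_structures.

Theorem theorem4p1 (R : realType) (M : pointedType) (C : set (M -> R))
    (hC : diff_structure C) (hM : hausdorff_space (tau C))
    (CM : completeType) (jC : M -> CM) (CC : set (CM -> R))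
    (hCC : diff_completion C C jC CC) :
  (forall (N : completeType) (j : M -> N) (D : set (N -> R)),
     (exists G : set (M -> R), diff_completion C G j D) ->
     exists iota : CM -> N,
       smooth_map CC D iota /\ (forall m, iota (jC m) = j m)) /\
  (forall g : M -> R, C g ->
     exists! gt : CM -> R, CC gt /\ (forall m, gt (jC m) = g m)).
Proof.
have [_ [_ _ dC UC] ->] := hCC.
split=> [N j D [G [genG [hN _ _ UN] ->]]|g Cg].
  have GC : G `<=` C by rewrite -genG; exact: sub_gen.
  have [|f [cf fj]] := extend_by_density dC hN (j := j).
    by rewrite UN UC; exact: unif_ent_sub.
  exists f; split=> //.
  apply: smooth_map_gen => [|h [ch Gh]]; first exact: diff_structure_gen.
  (* [h \o f] is itself a generator of the completed structure: it is continuous and restricts on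
     [M] to [h \o j], an element of [G], hence of [C]. *)
  apply: sub_gen; split=> [x|].
    by apply: continuous_comp; [exact: cf|exact: ch].
  rewrite (_ : _ \o _ = h \o j); first exact: GC.
  by apply/funext => m /=; rewrite fj.
have [|f [cf fg]] := extend_by_density dC (@Rhausdorff R) (j := g).
  by rewrite UC; exact: initial_ent_sub_unif_ent.
exists f; split=> [|f' [CCf' f'g]].
  split=> //; apply: sub_gen; split=> //.
  by rewrite (_ : _ \o _ = g) //; apply/funext.
(* A competitor [f'] is only known to lie in the generated structure; its continuity comes from that
   of the generators. *)
apply: (continuous_eq_on_dense (@Rhausdorff R) cf _ dC).
  by apply: gen_continuous CCf' => h [].
by move=> _ /[!inE] -[m _ <-]; rewrite fg f'g.
Qed.
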